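(* Let $A\in\mathbb{R}^{n\times d}$, $y\in\mathbb{R}^n$, $\lambda>0$, and let $W\in\mathbb{R}^{d\times k}$ satisfy $WW^T=I$. For $\eta>0$ consider, on $\mathbb{R}^d\times\mathbb{R}^k_+$, $$\mathsf{J}(u,\theta):=\frac1{2n}\|y-Au\|_2^2+\frac{\lambda}{2\sqrt2}\sum_{j=1}^k\frac{(W^Tu)_j^2}{\theta_j}+\frac{\lambda}{\sqrt2}\sum_{j=1}^k(\theta_j-\eta\log\theta_j).$$ Then: (1) $\mathsf{J}$ is strictly convex over $\mathbb{R}^d\times\mathbb{R}^k_+$ and admits a unique minimizer $(\hat u,\hat\theta)$. (2) For any initialization $\theta^0\in\mathbb{R}^k_+$, the iterates $u^\ell$ of the O-IAS algorithm $$u^{\ell+1}:=\Bigl(\frac{A^TA}{n}+\frac{\lambda}{\sqrt2}WD_{\theta^\ell}^{-1}W^T\Bigr)^{-1}\frac{A^Ty}{n},\qquad \theta_j^{\ell+1}:=\frac\eta2+\sqrt{\frac{\eta^2}{4}+\frac{(W^Tu^{\ell+1})_j^2}{2}},\quad 1\le j\le k,$$ where $D_\theta=\mathrm{diag}(\theta)$, converge at least linearly to $\hat u$ in the norm $\|\cdot\|_{(WD_{\hat\theta}^{-1}W^T)^{-1}}$. (3) $\hat u$ is the global minimizer over $\mathbb{R}^d$ of $\mathsf{F}(u):=\frac1{2n}\|y-Au\|_2^2+\lambda\mathsf{R}_\eta(u)$, where $$\mathsf{R}_\eta(u):=\frac1{\sqrt2}\sum_{j=1}^k\Bigl[\frac{(W^Tu)_j^2}{2f_j(u)}+f_j(u)-\eta\log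 f_j(u)\Bigr],\qquad f_j(u):=\frac\eta2+\sqrt{\frac{\eta^2}4+\frac{(W^Tu)_j^2}{2}}.$$
   Context: $\mathbb{R}^k_+=(0,\infty)^k$. For a symmetric positive definite matrix $C$, $\|x\|_C:=(x^TC^{-1}x)^{1/2}$ (Mahalanobis norm), so $\|x\|^2_{(WD_{\hat\theta}^{-1}W^T)^{-1}}=x^TWD_{\hat\theta}^{-1}W^Tx$. ''Converge at least linearly to $\hat u$ in a norm $\|\cdot\|$'' means that $u^\ell\to\hat u$ and there exist $\rho\in(0,1)$ and $\ell_0$ such that $\|u^{\ell+1}-\hat u\|\le\rho\|u^\ell-\hat u\|$ for all $\ell\ge\ell_0$. *)

(* Defs.v *)
(* MathComp / MathComp-Analysis; R^m is the type 'cV[R]_m of column vectors. *)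
From HB Require Import structures.
From mathcomp Require Import all_boot all_order all_algebra.
From mathcomp Require Import boolp classical_sets reals topology normedtype.
From mathcomp Require Import sequences exp convex.

Set Implicit Arguments.
Unset Strict Implicit.
Unset Printing Implicit Defensive.

Import Order.TTheory GRing.Theory Num.Theory.
Import numFieldNormedType.Exports.

Local Open Scope classical_set_scope.
Local Open Scope ring_scope.

Definition strictly_convex_on (R : numFieldType) (E : lmodType R)
    (D : set E) (f : E -> R) : Prop :=
  convex_set D /\
  forall (t : R) (x y : E), 0 < t -> t < 1 -> D x -> D y -> x <> y ->
    f (t *: x + (1 - t) *: y) < t * f x + (1 - t) * f y.

Definition is_minimizer (R : numDomainType) (E : Type)
    (D : set E) (f : E -> R) (x : E) : Prop :=
  D x /\ forall y : E, D y -> f x <= f y.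

(* The conjunction of "x is a minimizer" and "every minimizer is x". *)
Definition is_unique_minimizer (R : numDomainType) (E : Type)
    (D : set E) (f : E -> R) (x : E) : Prop :=
  unique (is_minimizer D f) x.

Definition pos_orthant (R : numDomainType) (k : nat) : set 'cV[R]_k :=
  [set theta | forall j, 0 < theta j 0].

Section Norms.
Context {R : realType}.

Definition norm2 (m : nat) (x : 'cV[R]_m) : R :=
  Num.sqrt (\sum_(i < m) x i 0 ^+ 2).

(* Meant for C symmetric positive definite: invmx C is C itself when C is
   singular. *)
Definition mahalanobis (m : nat) (C : 'M[R]_m) (x : 'cV[R]_m) : R :=
  Num.sqrt ((x^T *m invmx C *m x) 0 0).

(* The convergence u --> x is in the topology of 'cV[R]_m, that is,
   coordinatewise. *)
Definition converges_at_least_linearly (m : nat) (N : 'cV[R]_m -> R)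
    (u : nat -> 'cV[R]_m) (x : 'cV[R]_m) : Prop :=
  u @ \oo --> x /\
  exists (rho : R) (l0 : nat),
    [/\ 0 < rho, rho < 1 &
        forall l : nat, (l0 <= l)%N -> N (u l.+1 - x) <= rho * N (u l - x)].

End Norms.

Section IAS.
Context {R : realType} {n d k : nat}.
Variables (A : 'M[R]_(n, d)) (y : 'cV[R]_n) (lambda : R).
Variables (W : 'M[R]_(d, k)) (eta : R).

Definition diag_of (theta : 'cV[R]_k) : 'M[R]_k := diag_mx theta^T.

(* W D_theta^-1 W^T, which is symmetric positive definite when
   W W^T = I and theta > 0. *)
Definition prior_precision (theta : 'cV[R]_k) : 'M[R]_d :=
  W *m invmx (diag_of theta) *m W^T.

Definition data_fit (u : 'cV[R]_d) : R :=
  (2 * n%:R)^-1 * norm2 (y - A *m u) ^+ 2.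

Definition J (p : 'cV[R]_d * 'cV[R]_k) : R :=
  let u := p.1 in let theta := p.2 in
  data_fit u
  + lambda / (2 * Num.sqrt 2)
    * (\sum_(j < k) (W^T *m u) j 0 ^+ 2 / theta j 0)
  + lambda / Num.sqrt 2
    * (\sum_(j < k) (theta j 0 - eta * ln (theta j 0))).

Definition J_domain : set ('cV[R]_d * 'cV[R]_k) :=
  [set p | pos_orthant p.2].

(* The vector of the f_j(u); it is also the theta-update of O-IAS. *)
Definition f_ (u : 'cV[R]_d) : 'cV[R]_k :=
  \col_(j < k) (eta / 2
    + Num.sqrt (eta ^+ 2 / 4 + (W^T *m u) j 0 ^+ 2 / 2)).

Definition ias_u (theta : 'cV[R]_k) : 'cV[R]_d :=
  invmx (n%:R^-1 *: (A^T *m A)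
         + (lambda / Num.sqrt 2) *: prior_precision theta)
  *m (n%:R^-1 *: (A^T *m y)).

(* u 0 is unconstrained: the algorithm is started from theta 0. *)
Definition oias_iterates (theta0 : 'cV[R]_k)
    (u : nat -> 'cV[R]_d) (theta : nat -> 'cV[R]_k) : Prop :=
  [/\ theta 0%N = theta0,
      forall l : nat, u l.+1 = ias_u (theta l) &
      forall l : nat, theta l.+1 = f_ (u l.+1)].

Definition R_eta (u : 'cV[R]_d) : R :=
  (Num.sqrt 2)^-1 *
  \sum_(j < k) ((W^T *m u) j 0 ^+ 2 / (2 * f_ u j 0)
                + f_ u j 0 - eta * ln (f_ u j 0)).

Definition F (u : 'cV[R]_d) : R := data_fit u + lambda * R_eta u.

End IAS.

(* Main.v *)
(** Put w = W^T u and c = lambda / sqrt 2.  Then J(u, theta) is the data fit plus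
    c times the sum of w_j^2 / (2 theta_j) + theta_j - eta ln theta_j, which is
    strictly convex in (w_j, theta_j) and minimized over theta_j at f_j(u); hence
    F(u) = min_theta J(u, theta), and a minimizer uhat of F, which exists by
    coercivity, yields the minimizer (uhat, f(uhat)) of J.

    Subtracting the normal equations of the iterate u^+ (weights theta = f(u)) and
    of uhat, and testing against u^+ - uhat, gives the global contraction
      sum_j (W^T (u^+ - uhat))_j^2 / theta_j
        <= q sum_j (W^T (u - uhat))_j^2 / theta_j,   q < 1,
    because f_j is 1/sqrt 2-Lipschitz in w_j and w_j^2 = 2 f_j (f_j - eta).
    The weights change at each step, so convergence needs the energy as well: F
    decreases by at least c/2 sum_j (W^T (u - u^+))_j^2 / theta_j, which therefore
    tends to 0, and by the contraction so does the error.  Once theta is close to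
    thetahat, the contraction passes to the weights thetahat. *)
Require Import Defs.
From mathcomp Require Import all_boot all_order all_algebra.
From mathcomp Require Import boolp classical_sets reals topology normedtype.
From mathcomp Require Import interval_inference sequences exp convex realfun derive.
From mathcomp Require Import ring lra.

Set Implicit Arguments.
Unset Strict Implicit.
Unset Printing Implicit Defensive.

Import Order.TTheory GRing.Theory Num.Theory.
Import numFieldNormedType.Exports.
Local Open Scope classical_set_scope.
Local Open Scope ring_scope.

(** * Coordinatewise limits and uniqueness of minimizers *)

Lemma cvg_sum_ord (R : realType) (T : Type) (G : set_system T) (FG : Filter G) m
    (f : 'I_m -> T -> R) (l : 'I_m -> R) :
  (forall i, f i x @[x --> G] --> l i) ->
  (\sum_i f i x) @[x --> G] --> \sum_i l i.
Proof.
by move=> fl; apply: cvg_big => [|i _ //]; move=> z; apply: add_continuous.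
Qed.

(** A neighbourhood of a matrix contains a product of neighbourhoods of its finitely many
    entries. *)
Lemma cvg_matrix_coord (R : realType) (T : Type) (G : set_system T)
    (FG : Filter G) m p (f : T -> 'M[R]_(m, p)) (l : 'M[R]_(m, p)) :
  (forall i j, f x i j @[x --> G] --> l i j) -> f x @[x --> G] --> l.
Proof.
move=> fl B [P Pl PB]; apply: (filterS (P := [set x | forall i j, P i j (f x i j)])).
  by move=> x Px; apply: PB.
apply: filter_forall => i; apply: filter_forall => j; exact: fl (Pl i j).
Qed.

Lemma cvg_mulmx_coord (R : realType) (T : Type) (G : set_system T)
    (FG : Filter G) m p (B : 'M[R]_(m, p)) (g : T -> 'cV[R]_p) (u : 'cV[R]_p) i :
  (forall j, g x j 0 @[x --> G] --> u j 0) ->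
  (B *m g x) i 0 @[x --> G] --> (B *m u) i 0.
Proof.
move=> gu; rewrite mxE (_ : (fun x => _) = fun x => \sum_j B i j * g x j 0).
  by apply: cvg_sum_ord => j; apply: cvgM; [exact: cvg_cst | exact: gu].
by apply/funext => x; rewrite mxE.
Qed.

(** At the midpoint of two distinct minimizers the value would be smaller still. *)
Lemma strictly_convex_minimizer_unique (R : realType) (E : lmodType R)
    (D : set E) (f : E -> R) x :
  strictly_convex_on D f -> is_minimizer D f x -> is_unique_minimizer D f x.
Proof.
move=> [cD sD] [Dx xmin]; split=> [//|z [Dz zmin]].
have [//|/eqP xz] := eqVneq x z.
have h0 : (0 : R) < 2^-1 by rewrite invr_gt0.
have h1 : (2^-1 : R) < 1 by rewrite invf_lt1 // ltr1n.
have Dm : D (2^-1 *: x + (1 - 2^-1) *: z).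
  have := cD x z (Itv01 (ltW h0) (ltW h1)).
  by rewrite !inE => /(_ Dx Dz).
have := sD _ _ _ h0 h1 Dx Dz xz; have := xmin _ Dm; have := zmin _ Dx.
by move=> {xz} ? ? ?; exfalso; lra.
Qed.

(** * The scalar penalty [phi] and its minimizer in t *)

Section Scalar.
Variable R : realType.
Implicit Types (eta w v t s : R).

Lemma ln_lt_sub1 t : 0 < t -> t != 1 -> ln t < t - 1.
Proof.
move=> t0 t1; have h : ln t != 0 by rewrite ln_eq0.
by have := expR_gt1Dx h; rewrite lnK ?posrE // => ?; rewrite ltrBrDl.
Qed.

Lemma ln_le_tangent s t : 0 < s -> 0 < t -> ln t <= ln s + (t - s) / s.
Proof.
move=> s0 t0; have ts0 : 0 < t / s by rewrite divr_gt0.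
have -> : (t - s) / s = t / s - 1 by rewrite mulrBl divff // gt_eqF.
have -> : ln t = ln s + ln (t / s).
  by rewrite ln_div ?posrE // addrC subrK.
rewrite lerD2l; have [->|h] := eqVneq (t / s) 1; first by rewrite ln1 subrr.
exact/ltW/ln_lt_sub1.
Qed.

Lemma ln_lt_tangent s t : 0 < s -> 0 < t -> t != s ->
  ln t < ln s + (t - s) / s.
Proof.
move=> s0 t0 ts; have ts0 : 0 < t / s by rewrite divr_gt0.
have -> : (t - s) / s = t / s - 1 by rewrite mulrBl divff // gt_eqF.
have -> : ln t = ln s + ln (t / s).
  by rewrite ln_div ?posrE // addrC subrK.
rewrite ltrD2l; apply: ln_lt_sub1 => //; apply: contra ts => /eqP h.
by rewrite -(divfK (lt0r_neq0 s0) t) h mul1r.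
Qed.

(** Average the tangent bounds at the mean z, strict at x; the linear terms cancel. *)
Lemma ln_strict_concave t x y : 0 < t -> t < 1 -> 0 < x -> 0 < y -> x != y ->
  t * ln x + (1 - t) * ln y < ln (t * x + (1 - t) * y).
Proof.
move=> t0 t1 x0 y0 xy; set z := t * x + (1 - t) * y.
have t1' : 0 < 1 - t by rewrite subr_gt0.
have z0 : 0 < z by rewrite addr_gt0 // mulr_gt0.
have xz : x != z.
  rewrite -subr_eq0 (_ : x - z = (1 - t) * (x - y)); last by rewrite /z; ring.
  by rewrite mulf_neq0 ?subr_eq0 // gt_eqF.
have hx := ln_lt_tangent z0 x0 xz; have hy := ln_le_tangent z0 y0.
have -> : ln z = t * (ln z + (x - z) / z) + (1 - t) * (ln z + (y - z) / z).
  suff : t * ((x - z) / z) + (1 - t) * ((y - z) / z) = 0 by move=> h; lra.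
  rewrite !mulrA -mulrDl (_ : t * (x - z) + _ = 0) ?mul0r //.
  by rewrite /z; ring.
by apply: ltr_leD; [rewrite ltr_pM2l|rewrite ler_pM2l].
Qed.

(** The summand of J for one coordinate, up to the factor lambda / sqrt 2, with w = (W^T u)_j and t
    = theta_j. *)
Definition phi eta w t := w ^+ 2 / (2 * t) + t - eta * ln t.

Definition theta_opt eta w := eta / 2 + Num.sqrt (eta ^+ 2 / 4 + w ^+ 2 / 2).

(** The exact convexity gap of w^2 / (2 t), the perspective of w^2 / 2. It vanishes when w1 / x = w2
    / y, so this term alone is not strictly convex. *)
Lemma perspective_gap t w1 w2 x y : 0 < x -> 0 < y -> t * x + (1 - t) * y != 0 ->
  t * (w1 ^+ 2 / (2 * x)) + (1 - t) * (w2 ^+ 2 / (2 * y)) -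
    (t * w1 + (1 - t) * w2) ^+ 2 / (2 * (t * x + (1 - t) * y)) =
  t * (1 - t) * (w1 * y - w2 * x) ^+ 2 / (2 * x * y * (t * x + (1 - t) * y)).
Proof. by move=> /gt_eqF/negbT x0 /gt_eqF/negbT y0 z0; field; rewrite x0 y0 z0. Qed.

(** If x and y differ, strictness comes from the logarithm; otherwise w1 and w2 differ and the
    perspective gap is positive. *)
Lemma phi_strict_convex eta t w1 w2 x y : 0 < eta -> 0 < t -> t < 1 ->
  0 < x -> 0 < y -> (w1 != w2) || (x != y) ->
  phi eta (t * w1 + (1 - t) * w2) (t * x + (1 - t) * y) <
  t * phi eta w1 x + (1 - t) * phi eta w2 y.
Proof.
move=> eta0 t0 t1 x0 y0 neq.
have t1' : 0 < 1 - t by rewrite subr_gt0.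
have z0 : 0 < t * x + (1 - t) * y by rewrite addr_gt0 // mulr_gt0.
have gap := perspective_gap w1 w2 x0 y0 (lt0r_neq0 z0).
have den0 : 0 < 2 * x * y * (t * x + (1 - t) * y) by rewrite !mulr_gt0.
have gap0 := divr_ge0 (mulr_ge0 (ltW (mulr_gt0 t0 t1')) (sqr_ge0 (w1 * y - w2 * x)))
  (ltW den0).
rewrite -gap in gap0.
have [xy|xy] := eqVneq x y.
  subst y; move: neq; rewrite eqxx orbF => w12.
  have : 0 < t * (1 - t) * (w1 * x - w2 * x) ^+ 2 /
             (2 * x * x * (t * x + (1 - t) * x)).
    apply: divr_gt0 => //; apply: mulr_gt0; first exact: mulr_gt0.
    rewrite exprn_even_gt0 //= -mulrBl.
    by rewrite mulf_neq0 ?subr_eq0 // gt_eqF.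
  rewrite -gap /phi.
  have -> : t * x + (1 - t) * x = x by ring.
  by move=> h; lra.
have h := ln_strict_concave t0 t1 x0 y0 xy.
rewrite -(ltr_pM2l eta0) in h; rewrite /phi.
by move: gap0 h; rewrite mulrDr; set p := _ / _; set q := _ / _; set r := _ / _; nra.
Qed.

Section OptimalTheta.
Variable eta : R.
Hypothesis eta0 : 0 < eta.

(** This is the equation d phi / dt = 0, of which [theta_opt] is the larger root. *)
Lemma theta_opt_quadratic w :
  w ^+ 2 = 2 * theta_opt eta w * (theta_opt eta w - eta).
Proof.
have h : 0 <= eta ^+ 2 / 4 + w ^+ 2 / 2 by have := sqr_ge0 eta; have := sqr_ge0 w; lra.
have := sqr_sqrtr h; rewrite /theta_opt; set s := Num.sqrt _ => hs.
by rewrite (_ : w ^+ 2 = 2 * (s ^+ 2 - eta ^+ 2 / 4)); [field | lra].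
Qed.

Lemma theta_opt_ge w : eta <= theta_opt eta w.
Proof.
have : Num.sqrt ((eta / 2) ^+ 2) <= Num.sqrt (eta ^+ 2 / 4 + w ^+ 2 / 2).
  by rewrite ler_wsqrtr //; have := sqr_ge0 w; rewrite exprMn; lra.
by rewrite sqrtr_sqr ger0_norm /theta_opt; [lra | rewrite divr_ge0 // ltW].
Qed.

Lemma theta_opt_gt0 w : 0 < theta_opt eta w.
Proof. exact: lt_le_trans eta0 (theta_opt_ge w). Qed.

Lemma theta_opt_lipschitz w v :
  (theta_opt eta w - theta_opt eta v) ^+ 2 <= (w - v) ^+ 2 / 2.
Proof.
have pos x : 0 <= eta ^+ 2 / 4 + x ^+ 2 / 2.
  by have := sqr_ge0 eta; have := sqr_ge0 x; lra.
have := sqr_sqrtr (pos w); have := sqr_sqrtr (pos v).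
have := sqrtr_ge0 (eta ^+ 2 / 4 + w ^+ 2 / 2).
have := sqrtr_ge0 (eta ^+ 2 / 4 + v ^+ 2 / 2).
rewrite /theta_opt; set s := Num.sqrt _; set r := Num.sqrt _ => s0 r0 hs hr.
(* Cauchy-Schwarz for the vectors (eta / 2, w / sqrt 2) and (eta / 2, v / sqrt 2), whose norms are
   the two square roots. *)
suff : eta ^+ 2 / 4 + w * v / 2 <= r * s by move=> h; nra.
apply: le_trans (ler_norm _) _.
rewrite -(@ler_pXn2r _ 2) ?nnegrE ?mulr_ge0 // real_normK ?num_real //.
rewrite exprMn hs hr -subr_ge0.
have -> : (eta ^+ 2 / 4 + w ^+ 2 / 2) * (eta ^+ 2 / 4 + v ^+ 2 / 2) -
   (eta ^+ 2 / 4 + w * v / 2) ^+ 2 = (eta * (w - v)) ^+ 2 / 8 by field.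
by rewrite divr_ge0 ?sqr_ge0.
Qed.

(** After ln t is bounded by its tangent at f, the difference is (f - eta) (t - f)^2 / (t f),
    nonnegative because f >= eta. *)
Lemma phi_theta_opt_le w t : 0 < t -> phi eta w (theta_opt eta w) <= phi eta w t.
Proof.
move=> t0; have := theta_opt_quadratic w; have := theta_opt_ge w.
have := theta_opt_gt0 w; rewrite /phi; set f := theta_opt eta w => f0 fe ->.
have := ln_le_tangent f0 t0; rewrite -(ler_pM2l eta0) mulrDr => h.
suff : 2 * f * (f - eta) / (2 * f) + f + eta * ((t - f) / f)
    <= 2 * f * (f - eta) / (2 * t) + t by lra.
rewrite -subr_ge0.
have -> : 2 * f * (f - eta) / (2 * t) + t -
    (2 * f * (f - eta) / (2 * f) + f + eta * ((t - f) / f)) =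
    (f - eta) * (t - f) ^+ 2 / (t * f).
  by field; rewrite ?gt_eqF.
apply: divr_ge0; last exact/ltW/mulr_gt0.
by apply: mulr_ge0; rewrite ?sqr_ge0 ?subr_ge0.
Qed.

Definition phi_floor := eta - eta * ln (2 * eta).

(* The tangent of ln at 2 * eta leaves half of the linear term t. *)
Lemma phi_ge_floor w t : 0 < t ->
  w ^+ 2 / (2 * t) + t / 2 + phi_floor <= phi eta w t.
Proof.
move=> t0; have e0 : 0 < 2 * eta by rewrite mulr_gt0.
have := ln_le_tangent e0 t0; rewrite -(ler_pM2l eta0) mulrDr.
have -> : eta * ((t - 2 * eta) / (2 * eta)) = t / 2 - eta by field; rewrite ?gt_eqF.
by rewrite /phi /phi_floor; lra.
Qed.

Lemma phi_ge_theta w t : 0 < t -> t / 2 + phi_floor <= phi eta w t.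
Proof.
move=> t0; apply: le_trans (phi_ge_floor w t0).
by rewrite lerD2r lerDr divr_ge0 ?sqr_ge0 // mulr_ge0 // ltW.
Qed.

(** By the arithmetic-geometric mean inequality, w^2 / (2 t) + t / 2 >= |w|; this is the source of
    coercivity. *)
Lemma phi_ge_abs w t : 0 < t -> `|w| + phi_floor <= phi eta w t.
Proof.
move=> t0; apply: le_trans (phi_ge_floor w t0); rewrite lerD2r -subr_ge0.
rewrite -(real_normK (num_real w)).
have -> : `|w| ^+ 2 / (2 * t) + t / 2 - `|w| = (`|w| - t) ^+ 2 / (2 * t).
  by field; rewrite ?gt_eqF.
by rewrite divr_ge0 ?sqr_ge0 // mulr_ge0 // ltW.
Qed.

(* The factor 1 - eta / M combines the Lipschitz bound for theta_opt with
   v ^+ 2 / (2 g ^+ 2) = 1 - eta / g <= 1 - eta / M for g := theta_opt eta v. *)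
Lemma weight_gap_bound M a w v : theta_opt eta v <= M ->
  a * ((theta_opt eta v)^-1 - (theta_opt eta w)^-1) * v <=
  (a ^+ 2 + (1 - eta / M) * (w - v) ^+ 2) / (2 * theta_opt eta w).
Proof.
move=> hM; have := theta_opt_lipschitz w v; have := theta_opt_quadratic v.
have := theta_opt_gt0 v; have := theta_opt_gt0 w.
set f := theta_opt eta w; set g := theta_opt eta v => f0 g0 hv hl.
have M0 : 0 < M by apply: lt_le_trans hM.
have -> : a * (g^-1 - f^-1) * v = (2 * a * ((f - g) * v / g)) / (2 * f).
  by field; rewrite ?gt_eqF.
rewrite ler_pM2r ?invr_gt0 ?mulr_gt0 //; set z := (f - g) * v / g.
have hz : z ^+ 2 <= (1 - eta / M) * (w - v) ^+ 2.
  have -> : z ^+ 2 = (1 - eta / g) * (2 * (f - g) ^+ 2).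
    by rewrite /z expr_div_n exprMn hv; field; rewrite ?gt_eqF.
  apply: ler_pM => //.
  - by rewrite subr_ge0 ler_pdivrMr // mul1r theta_opt_ge.
  - by rewrite mulr_ge0 ?sqr_ge0.
  - by rewrite lerD2l lerN2 ler_pM2l // lef_pV2.
  - by lra.
by have := sqr_ge0 (a - z); nra.
Qed.

Lemma theta_opt_continuous : continuous (theta_opt eta).
Proof.
move=> w; apply: cvgD; first exact: cvg_cst.
apply: (@continuous_cvg _ _ _ _ _ _ Num.sqrt); first exact: sqrt_continuous.
by apply: cvgD; [exact: cvg_cst | apply: cvgM; [exact: exprn_continuous | exact: cvg_cst]].
Qed.

Lemma phi_theta_opt_continuous :
  continuous (fun w => phi eta w (theta_opt eta w)).
Proof.
move=> w; have tc := @theta_opt_continuous w.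
apply: cvgB; first apply: cvgD.
- apply: cvgM; first exact: exprn_continuous.
  apply: cvgV; last by apply: cvgM; [exact: cvg_cst | exact: tc].
  by rewrite mulf_neq0 // gt_eqF // theta_opt_gt0.
- exact: tc.
- apply: cvgM; first exact: cvg_cst.
  apply: (@continuous_cvg _ _ _ _ _ _ (@ln R)); last exact: tc.
  exact/continuous_ln/theta_opt_gt0.
Qed.

End OptimalTheta.
End Scalar.

(** * Coordinate formulas and the inverse of a diagonal matrix *)

Lemma sub_colE (R : realType) m (x z : 'cV[R]_m) i : (x - z) i 0 = x i 0 - z i 0.
Proof. by rewrite !mxE. Qed.

Lemma dot_colE (R : realType) m (x z : 'cV[R]_m) :
  (x^T *m z) 0 0 = \sum_i x i 0 * z i 0.
Proof. by rewrite mxE; apply: eq_bigr => i _; rewrite mxE. Qed.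

Lemma invmx_diag_of (R : realType) k (theta : 'cV[R]_k) : pos_orthant theta ->
  invmx (diag_of theta) = diag_mx (\row_j (theta j 0)^-1).
Proof.
move=> pth; set D' := diag_mx _.
have DD' : diag_of theta *m D' = 1%:M.
  rewrite /diag_of mulmx_diag -diag_const_mx; congr diag_mx.
  by apply/rowP => j; rewrite !mxE mulfV // lt0r_neq0 //; exact: pth.
have [uD _] := mulmx1_unit DD'.
by rewrite -[LHS]mulmx1 -DD' mulmxA mulVmx // mul1mx.
Qed.

(** * The objectives J and F, and strict convexity of J *)

Section Objective.
Variables (R : realType) (n d k : nat) (A : 'M[R]_(n, d)) (y : 'cV[R]_n).
Variables (lambda : R) (W : 'M[R]_(d, k)) (eta : R).
Hypotheses (n_gt0 : (0 < n)%N) (lambda_gt0 : 0 < lambda).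
Hypotheses (WWT : W *m W^T = 1%:M) (eta_gt0 : 0 < eta).

Local Notation c := (lambda / Num.sqrt 2).
Local Notation wt u j := ((W^T *m u) j 0).
Local Notation Jf u theta := (J A y lambda W eta (u, theta)).
Local Notation Ff := (F A y lambda W eta).

Lemma c_gt0 : 0 < c.
Proof. by rewrite divr_gt0 // sqrtr_gt0. Qed.

Lemma natn_gt0 : 0 < n%:R :> R.
Proof. by rewrite ltr0n. Qed.

Lemma data_fitE u :
  data_fit A y u = (2 * n%:R)^-1 * \sum_i (y - A *m u) i 0 ^+ 2.
Proof.
by rewrite /data_fit /norm2 sqr_sqrtr // sumr_ge0 // => i _; exact: sqr_ge0.
Qed.

Lemma data_fit_ge0 u : 0 <= data_fit A y u.
Proof. by apply: mulr_ge0; [rewrite invr_ge0 mulr_ge0 | exact: sqr_ge0]. Qed.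

Lemma J_phi u theta :
  Jf u theta = data_fit A y u + c * \sum_j phi eta (wt u j) (theta j 0).
Proof.
rewrite /J /= -addrA; congr (_ + _).
have -> : lambda / (2 * Num.sqrt 2) = c / 2 by rewrite invfM; ring.
rewrite -mulrA -mulrDr; congr (_ * _).
rewrite mulr_sumr -big_split; apply: eq_bigr => j _ /=.
by rewrite /phi invfM; ring.
Qed.

Lemma f_E (u : 'cV[R]_d) j : f_ W eta u j 0 = theta_opt eta (wt u j).
Proof. by rewrite mxE. Qed.

Lemma pos_f_ (u : 'cV[R]_d) : pos_orthant (f_ W eta u).
Proof. by move=> j; rewrite f_E theta_opt_gt0. Qed.

Lemma F_J u : Ff u = Jf u (f_ W eta u).
Proof.
by rewrite J_phi /F /R_eta mulrA.
Qed.

Lemma F_le_J u theta : pos_orthant theta -> Ff u <= Jf u theta.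
Proof.
move=> pth; rewrite F_J !J_phi lerD2l ler_pM2l ?c_gt0 //.
by apply: ler_sum => j _; rewrite f_E phi_theta_opt_le.
Qed.

Lemma WT_inj (u v : 'cV[R]_d) : W^T *m u = W^T *m v -> u = v.
Proof. by move=> h; rewrite -[u]mul1mx -[v]mul1mx -WWT -!mulmxA h. Qed.

Lemma data_fit_convex t u v : 0 < t -> t < 1 ->
  data_fit A y (t *: u + (1 - t) *: v) <=
  t * data_fit A y u + (1 - t) * data_fit A y v.
Proof.
move=> t0 t1; rewrite !data_fitE !(mulrCA _ (2 * n%:R)^-1) -mulrDr.
rewrite ler_pM2l ?invr_gt0 ?mulr_gt0 ?natn_gt0 // !mulr_sumr -big_split /=.
apply: ler_sum => i _; rewrite mulmxDr -!scalemxAr !mxE.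
set a := \sum_(_ | _) _; set b := \sum_(_ | _) _; rewrite -subr_ge0.
have -> : t * (y i 0 - a) ^+ 2 + (1 - t) * (y i 0 - b) ^+ 2 -
  (y i 0 - (t * a + (1 - t) * b)) ^+ 2 = t * (1 - t) * (a - b) ^+ 2 by ring.
by apply: mulr_ge0; [apply: mulr_ge0; lra | exact: sqr_ge0].
Qed.

(** The data fit contributes plain convexity. Strictness comes from one coordinate: W^T is
    injective, so distinct points differ in some w_j or theta_j. *)
Lemma J_strictly_convex : strictly_convex_on J_domain (J A y lambda W eta).
Proof.
split=> [[u th] [v ta] t|t [u th] [v ta] t0 t1].
  rewrite !inE => pu pv j /=; rewrite !mxE /=.
  have t0 : 0 <= t%:num by [].
  have t1 : t%:num <= 1 by [].
  move: (pu j) (pv j) t0 t1 => /=; rewrite /unstable.onem.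
  move: (t%:num) (th j 0) (ta j 0) => {pu pv}s x z x0 z0.
  (* [convex_set] includes the endpoint t = 0, where the first summand is not positive. *)
  rewrite le_eqVlt => /predU1P[<- _|s0 s1]; first by rewrite mul0r add0r subr0 mul1r.
  by apply: ltr_wpDr; rewrite ?mulr_gt0 // mulr_ge0 ?subr_ge0 // ltW.
rewrite /J_domain /= => pth pta neq.
have jE j : wt (t *: u + (1 - t) *: v) j = t * wt u j + (1 - t) * wt v j.
  by rewrite mulmxDr -!scalemxAr !mxE.
have tE j : (t *: th + (1 - t) *: ta) j 0 = t * th j 0 + (1 - t) * ta j 0.
  by rewrite !mxE.
rewrite !J_phi !mulrDr addrACA.
apply: ler_ltD; first exact: data_fit_convex.
rewrite !(mulrCA _ c) -mulrDr ltr_pM2l ?c_gt0 // !mulr_sumr -big_split /=.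
have [j0 hj0] : exists j, (wt u j != wt v j) || (th j 0 != ta j 0).
  apply/existsP; rewrite -[X in is_true X]negbK negb_exists.
  apply/negP => /forallP h; apply: neq; congr pair.
    apply: WT_inj; apply/colP => j.
    by have := h j; rewrite negb_or !negbK => /andP[/eqP].
  by apply/colP => j; have := h j; rewrite negb_or !negbK => /andP[_ /eqP].
rewrite (bigD1 j0) //= [ltRHS](bigD1 j0) //=; apply: ltr_leD.
  by rewrite jE tE; apply: phi_strict_convex.
apply: ler_sum => j _; rewrite jE tE.
have [hj|] := boolP ((wt u j != wt v j) || (th j 0 != ta j 0)).
  by apply/ltW/phi_strict_convex.
rewrite negb_or !negbK => /andP[/eqP -> /eqP ->].
have e (x : R) : t * x + (1 - t) * x = x by ring.
by rewrite !e.
Qed.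

(** * The normal equations and quadratic growth of J in u *)

Lemma prior_precisionE theta (x z : 'cV[R]_d) : pos_orthant theta ->
  (x^T *m prior_precision W theta *m z) 0 0 =
  \sum_j wt x j * wt z j / theta j 0.
Proof.
move=> pth; rewrite /prior_precision invmx_diag_of //.
have -> : x^T *m (W *m diag_mx (\row_j (theta j 0)^-1) *m W^T) *m z =
  (W^T *m x)^T *m (diag_mx (\row_j (theta j 0)^-1) *m (W^T *m z)).
  by rewrite trmx_mul trmxK !mulmxA.
by rewrite dot_colE; apply: eq_bigr => j _; rewrite mul_diag_mx !mxE; ring.
Qed.

(* Weak form of the normal equation
   (A^T A / n + c W D_theta^-1 W^T) p = A^T y / n. *)
Definition stationary (theta : 'cV[R]_k) (p : 'cV[R]_d) := forall v : 'cV[R]_d,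
  n%:R^-1 * (\sum_i (A *m p) i 0 * (A *m v) i 0) +
  c * (\sum_j wt p j * wt v j / theta j 0) =
  n%:R^-1 * \sum_i y i 0 * (A *m v) i 0.

(** Positive definiteness of W D_theta^-1 W^T, from the injectivity of W^T. *)
Lemma sum_wt_gt0 theta (v : 'cV[R]_d) : pos_orthant theta -> v != 0 ->
  0 < \sum_j wt v j ^+ 2 / theta j 0.
Proof.
move=> pth v0; rewrite lt_def sumr_ge0 ?andbT; last first.
  by move=> j _; rewrite divr_ge0 ?sqr_ge0 // ltW // pth.
apply: contra v0 => /eqP /psumr_eq0P h; apply/eqP/WT_inj/colP => j.
have /eqP := h (fun j _ => divr_ge0 (sqr_ge0 (wt v j)) (ltW (pth j))) j isT.
by rewrite mulf_eq0 sqrf_eq0 invr_eq0 (gt_eqF (pth j)) orbF mulmx0 => /eqP ->; rewrite mxE.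
Qed.

Lemma normal_matrixE theta (x z : 'cV[R]_d) : pos_orthant theta ->
  (x^T *m (n%:R^-1 *: (A^T *m A) + c *: prior_precision W theta) *m z) 0 0 =
  n%:R^-1 * (\sum_i (A *m x) i 0 * (A *m z) i 0) +
  c * (\sum_j wt x j * wt z j / theta j 0).
Proof.
move=> pth; have sc e (M : 'M[R]_(1, 1)) : (e *: M) 0 0 = e * M 0 0 by rewrite mxE.
rewrite mulmxDr mulmxDl -!scalemxAr -!scalemxAl [LHS]mxE !sc prior_precisionE //.
by congr (_ * _ + _); rewrite -dot_colE trmx_mul !mulmxA.
Qed.

(** A kernel vector would make the quadratic form vanish, while its prior part is positive. Hence
    [invmx] in [ias_u] is a genuine inverse. *)
Lemma normal_matrix_unit theta : pos_orthant theta ->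
  n%:R^-1 *: (A^T *m A) + c *: prior_precision W theta \in unitmx.
Proof.
move=> pth; rewrite unitmxE unitfE; apply/negP => /det0P[v v0 vH].
have := normal_matrixE v^T v^T pth; rewrite trmxK vH mul0mx mxE => /esym h.
have v0' : v^T != 0 by apply: contra v0 => /eqP h0; rewrite -[v]trmxK h0 trmx0.
have : 0 < c * \sum_j wt v^T j ^+ 2 / theta j 0.
  by rewrite mulr_gt0 ?c_gt0 ?sum_wt_gt0.
have : 0 <= n%:R^-1 * (\sum_i (A *m v^T) i 0 * (A *m v^T) i 0).
  rewrite mulr_ge0 // sumr_ge0 // => i _; exact: sqr_ge0.
by under [X in c * X]eq_bigr do rewrite expr2; lra.
Qed.

Lemma ias_u_stationary theta : pos_orthant theta ->
  stationary theta (ias_u A y lambda W theta).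
Proof.
move=> pth v; set p := ias_u _ _ _ _ _.
under eq_bigr do rewrite mulrC; under [X in _ + c * X]eq_bigr do rewrite [wt p _ * _]mulrC.
rewrite -normal_matrixE // -mulmxA.
rewrite /p /ias_u mulKVmx ?normal_matrix_unit // -scalemxAr mxE; congr (_ * _).
rewrite mulmxA -trmx_mul dot_colE; by apply: eq_bigr => i _; rewrite mulrC.
Qed.

(* J is quadratic in u for fixed theta, so this is an exact Taylor expansion. *)
Lemma J_expansion theta p v : stationary theta p ->
  Jf (p + v) theta = Jf p theta + (2 * n%:R)^-1 * (\sum_i (A *m v) i 0 ^+ 2)
    + c / 2 * \sum_j wt v j ^+ 2 / theta j 0.
Proof.
move=> /(_ v) st; rewrite !J_phi !data_fitE !mulmxDr.
have -> : \sum_i (y - (A *m p + A *m v)) i 0 ^+ 2 =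
  \sum_i (y - A *m p) i 0 ^+ 2 - 2 * (\sum_i y i 0 * (A *m v) i 0)
  + 2 * (\sum_i (A *m p) i 0 * (A *m v) i 0) + \sum_i (A *m v) i 0 ^+ 2.
  rewrite !mulr_sumr -sumrB -!big_split; apply: eq_bigr => i _.
  rewrite !sub_colE [(A *m p + A *m v) i 0]mxE /=; ring.
have -> : \sum_j phi eta ((W^T *m p + W^T *m v) j 0) (theta j 0) =
  \sum_j phi eta (wt p j) (theta j 0) + \sum_j wt p j * wt v j / theta j 0
  + 2^-1 * \sum_j wt v j ^+ 2 / theta j 0.
  rewrite !mulr_sumr -!big_split; apply: eq_bigr => j _ /=.
  by rewrite [(W^T *m p + W^T *m v) j 0]mxE /phi invfM; move: (theta j 0)^-1 => z; field.
move: st; set a := \sum_(i < n) _ * _; set b := \sum_(j < k) _ * _ / _.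
set e := \sum_(i < n) _ * _ => st.
have nE : n%:R^-1 = 2 * (2 * n%:R)^-1 :> R by rewrite invfM mulrA divff // mul1r.
rewrite nE in st; lra.
Qed.

Lemma J_quadratic_growth theta p u : pos_orthant theta -> stationary theta p ->
  Jf p theta + c / 2 * (\sum_j wt (u - p) j ^+ 2 / theta j 0) <= Jf u theta.
Proof.
move=> pth st; have := J_expansion (u - p) st; rewrite addrC subrK => ->.
rewrite lerD2r lerDl mulr_ge0 ?invr_ge0 ?mulr_ge0 // sumr_ge0 // => i _.
exact: sqr_ge0.
Qed.

(** No differentiation: J(., theta) grows quadratically away from the stationary point [ias_u], so a
    minimizer must coincide with it. *)
Lemma minimizer_stationary theta u : pos_orthant theta ->
  (forall v, Jf u theta <= Jf v theta) -> stationary theta u.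
Proof.
move=> pth umin; have st := ias_u_stationary pth.
have := le_trans (J_quadratic_growth u pth st) (umin (ias_u A y lambda W theta)); rewrite gerDl => h.
have [/eqP|neq] := eqVneq (u - ias_u A y lambda W theta) 0.
  by rewrite subr_eq0 => /eqP ->.
by move: h; rewrite leNgt mulr_gt0 // ?sum_wt_gt0 // divr_gt0 ?c_gt0.
Qed.

(** * Continuity and coercivity of F; existence of a minimizer *)

Lemma F_cvg (T : Type) (G : set_system T) (FG : Filter G) (g : T -> 'cV[R]_d)
    (u : 'cV[R]_d) :
  (forall i, g x i 0 @[x --> G] --> u i 0) -> Ff (g x) @[x --> G] --> Ff u.
Proof.
move=> gu; rewrite F_J J_phi data_fitE.
rewrite (_ : (fun x => _) = fun x => (2 * n%:R)^-1 *
    (\sum_i (y i 0 - (A *m g x) i 0) ^+ 2) + c *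
    \sum_j phi eta (wt (g x) j) (theta_opt eta (wt (g x) j))); last first.
  apply/funext => x; rewrite F_J J_phi data_fitE; congr (_ * _ + _ * _).
    by apply: eq_bigr => i _; rewrite sub_colE.
  by apply: eq_bigr => j _; rewrite f_E.
apply: cvgD; apply: cvgM; try exact: cvg_cst.
  apply: cvg_sum_ord => i; rewrite sub_colE.
  have rc : y i 0 - (A *m g x) i 0 @[x --> G] --> y i 0 - (A *m u) i 0.
    by apply: cvgB; [exact: cvg_cst | exact: cvg_mulmx_coord].
  exact: continuous_cvg (@exprn_continuous R 2 _) rc.
apply: cvg_sum_ord => j; rewrite f_E.
have wc : wt (g x) j @[x --> G] --> wt u j by exact: cvg_mulmx_coord.
exact: continuous_cvg (@phi_theta_opt_continuous _ _ eta_gt0 _) wc.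
Qed.

(* F is at least c times the sum of k terms, each at least the floor. *)
Definition sublevel_bound (K : R) := K / c - k%:R * phi_floor eta.

(** The data fit is nonnegative and the other k - 1 summands are at least [phi_floor eta], which
    caps the remaining one. *)
Lemma F_sublevel u K j : Ff u <= K ->
  `|wt u j| <= sublevel_bound K /\ f_ W eta u j 0 <= 2 * sublevel_bound K.
Proof.
move=> FK; have pth := pos_f_ u.
suff h : phi eta (wt u j) (f_ W eta u j 0) - phi_floor eta <= sublevel_bound K.
  have := phi_ge_abs eta_gt0 (wt u j) (pth j).
  have := phi_ge_theta eta_gt0 (wt u j) (pth j).
  by move: (f_ _ _ _ _ _) (phi _ _ _) h => t p h h1 h2; split; lra.
have hs : \sum_j phi eta (wt u j) (f_ W eta u j 0) <= K / c.
  rewrite ler_pdivlMr ?c_gt0 // mulrC; apply: le_trans FK.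
  by rewrite F_J J_phi lerDr data_fit_ge0.
rewrite /sublevel_bound lerBrDr.
apply: le_trans hs; rewrite mulr_natl -[X in _ *+ X]card_ord -sumr_const.
rewrite (bigD1 j) //= [leRHS](bigD1 j) //= addrA subrK lerD2l.
apply: ler_sum => i _; apply: le_trans (phi_ge_abs eta_gt0 (wt u i) (pth i)).
by rewrite lerDr.
Qed.

Lemma synthesis (u : 'cV[R]_d) : u = W *m (W^T *m u).
Proof. by rewrite mulmxA WWT mul1mx. Qed.

(** The points with F u <= F 0 lie in a compact box, on which F attains its minimum; elsewhere F
    exceeds F 0, and 0 is in the box. *)
Lemma F_minimizer_exists : exists u, forall v, Ff u <= Ff v.
Proof.
pose M i := \sum_j `|W i j| * sublevel_bound (Ff 0).
have inM u i : Ff u <= Ff 0 -> `|u i 0| <= M i.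
  move=> Fu; rewrite [u]synthesis mxE; apply: le_trans (ler_norm_sum _ _ _) _.
  apply: ler_sum => j _; rewrite normrM ler_wpM2l //.
  by have [] := F_sublevel j Fu.
(* [M] bounds the coordinates through u = W (W^T u). The box consists of row vectors, to apply
   [rV_compact], hence the transposes. *)
pose B := [set v : 'rV[R]_d | forall i, `[- M i, M i] (v ord0 i)]%classic.
have cB : compact B := rV_compact (fun i => @segment_compact R (- M i) (M i)).
have inB u : Ff u <= Ff 0 -> B u^T.
  by move=> Fu i /=; rewrite in_itv /= mxE -ler_norml inM.
have B0 : B !=set0 by exists 0^T; exact: inB.
have Fc : {within B, continuous (fun v : 'rV[R]_d => Ff v^T)}.
  apply: continuous_subspaceT => v; apply: (F_cvg (nbhs_filter v)) => i.
  rewrite mxE (_ : (fun x : 'rV[R]_d => x^T i 0) = fun x => x 0 i).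
    exact: coord_continuous.
  by apply/funext => x; rewrite mxE.
have [v _ vmin] := compact_EVT_min B0 cB Fc.
exists v^T => u; have [Fu|/ltW Fu] := leP (Ff u) (Ff 0).
  by have := vmin u^T; rewrite inE trmxK; apply; exact: inB.
apply: le_trans Fu; have := vmin 0^T; rewrite inE trmxK; apply; exact: inB.
Qed.

(** * Uniqueness of the minimizers and the one-step estimates *)

Section AtMinimizer.
Variables (uhat : 'cV[R]_d).
Hypothesis uhat_min : forall v, Ff uhat <= Ff v.
Local Notation thetahat := (f_ W eta uhat).

Lemma J_min u theta : pos_orthant theta -> Jf uhat thetahat <= Jf u theta.
Proof. by move=> pth; rewrite -F_J (le_trans (uhat_min u)) ?F_le_J. Qed.

Lemma J_unique_minimizer :
  is_unique_minimizer J_domain (J A y lambda W eta) (uhat, thetahat).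
Proof.
apply: strictly_convex_minimizer_unique; first exact: J_strictly_convex.
by split=> [|[u theta] pth]; [exact: pos_f_ | exact: J_min].
Qed.

(** Every minimizer v of F yields the minimizer (v, f(v)) of J, which is unique. *)
Lemma F_unique_minimizer : is_unique_minimizer setT Ff uhat.
Proof.
split=> [//|v [_ vmin]]; have [_ Juniq] := J_unique_minimizer.
suff : (uhat, thetahat) = (v, f_ W eta v) by case.
apply: Juniq; split=> [|[u theta] pth]; first exact: pos_f_.
by rewrite -F_J (le_trans (vmin u I)) ?F_le_J.
Qed.

Lemma uhat_stationary : stationary thetahat uhat.
Proof. by apply: minimizer_stationary => [|v]; [exact: pos_f_ | apply: J_min; exact: pos_f_]. Qed.

(* Any common upper bound of eta and of the thetahat_j would do. *)
Definition theta_cap := eta + \sum_j thetahat j 0.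
Definition contraction_rate := 1 - eta / theta_cap.

Lemma thetahat_le_cap j : thetahat j 0 <= theta_cap.
Proof.
rewrite /theta_cap (bigD1 j) //= addrCA lerDl.
apply: addr_ge0; first exact: ltW.
by apply: sumr_ge0 => i _; exact/ltW/pos_f_.
Qed.

Lemma theta_cap_ge : eta <= theta_cap.
Proof. by rewrite lerDl sumr_ge0 // => i _; exact/ltW/pos_f_. Qed.

Lemma contraction_rate_ge0 : 0 <= contraction_rate.
Proof.
rewrite subr_ge0 ler_pdivrMr ?mul1r ?theta_cap_ge //.
exact: lt_le_trans theta_cap_ge.
Qed.

Lemma contraction_rate_lt1 : contraction_rate < 1.
Proof. by rewrite gtrBl divr_gt0 // (lt_le_trans eta_gt0 theta_cap_ge). Qed.

(* The error equation is the difference of the two stationarity conditions tested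
   against p - uhat; the A-part has a favourable sign and is dropped. *)
Lemma step_contraction u p : stationary (f_ W eta u) p ->
  \sum_j wt (p - uhat) j ^+ 2 / f_ W eta u j 0 <=
  contraction_rate * \sum_j wt (u - uhat) j ^+ 2 / f_ W eta u j 0.
Proof.
move=> stp; have := stp (p - uhat); have := uhat_stationary (p - uhat).
move=> <- /eqP; rewrite -subr_eq0 opprD addrACA -!mulrBr -!sumrB => /eqP e0.
have hA : 0 <= \sum_i ((A *m p) i 0 * (A *m (p - uhat)) i 0 -
                       (A *m uhat) i 0 * (A *m (p - uhat)) i 0).
  apply: sumr_ge0 => i _; by rewrite -mulrBl mulmxBr sub_colE -expr2 sqr_ge0.
have hW : \sum_j (wt p j * wt (p - uhat) j / f_ W eta u j 0 -
    wt uhat j * wt (p - uhat) j / thetahat j 0) <= 0.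
  have := c_gt0; have : 0 <= n%:R^-1 :> R by rewrite invr_ge0.
  by move: e0 hA; set a := \sum_(i < n) _; set b := \sum_(j < k) _ => *; nra.
(* [weight_gap_bound] bounds the effect of the differing weights by half of each sum; the half in p
   - uhat is absorbed at the end. *)
have hj : \sum_j wt (p - uhat) j ^+ 2 / f_ W eta u j 0 <= \sum_j
   (2^-1 * (wt (p - uhat) j ^+ 2 / f_ W eta u j 0) +
    2^-1 * (contraction_rate * (wt (u - uhat) j ^+ 2 / f_ W eta u j 0))) .
  rewrite -subr_le0 -sumrB; apply: le_trans hW; apply: ler_sum => j _.
  have := @weight_gap_bound _ eta eta_gt0 theta_cap (wt (p - uhat) j) (wt u j)
    (wt uhat j).
  rewrite -!f_E -/contraction_rate thetahat_le_cap => /(_ isT).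
  have eB v : wt (v - uhat) j = wt v j - wt uhat j by rewrite mulmxBr sub_colE.
  rewrite !eB invfM; move: (wt p j) (wt u j) (wt uhat j) => a b e.
  move: (f_ W eta u j 0)^-1 (thetahat j 0)^-1 contraction_rate => f g q; lra.
move: hj; rewrite big_split -!mulr_sumr /=; lra.
Qed.

(** Majorization-minimization: J(., f(u)) lies above F, agrees with it at u, and is minimized at p
    with quadratic growth. *)
Lemma F_decrease u p : stationary (f_ W eta u) p ->
  Ff p + c / 2 * (\sum_j wt (u - p) j ^+ 2 / f_ W eta u j 0) <= Ff u.
Proof.
move=> stp; rewrite [leRHS]F_J; have pth := pos_f_ u.
apply: le_trans (J_quadratic_growth u pth stp).
by rewrite lerD2r F_le_J.
Qed.

(* By contraction, the distance to uhat is controlled by the length of the step,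
   and the length of the step by the decrease of F. *)
Lemma dist_le_decrease : exists2 C, 0 <= C & forall u p,
  stationary (f_ W eta u) p ->
  \sum_j wt (u - uhat) j ^+ 2 / f_ W eta u j 0 <= C * (Ff u - Ff p).
Proof.
have q0 := contraction_rate_ge0; have q1 := contraction_rate_lt1.
(* With q = 1 - 2 tau one has (1 + tau) q <= 1 - tau, so Young's inequality with parameter tau
   leaves tau Y <= (1 + 1 / tau) E. *)
set q := contraction_rate in q0 q1; pose tau := (1 - q) / 2.
have tau0 : 0 < tau by rewrite divr_gt0 // subr_gt0.
have i0 : 0 < tau^-1 by rewrite invr_gt0.
exists (tau^-1 * (1 + tau^-1) * (2 / c)) => [|u p stp].
  by rewrite !mulr_ge0 ?invr_ge0 ?ltW ?addr_gt0 ?c_gt0.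
have := step_contraction stp; have := F_decrease stp.
rewrite -/q; set Y := \sum_j wt (u - uhat) j ^+ 2 / _.
set X := \sum_j wt (p - uhat) j ^+ 2 / _.
set E := \sum_j wt (u - p) j ^+ 2 / _ => hE hX.
have hY : Y <= (1 + tau) * X + (1 + tau^-1) * E.
  rewrite !mulr_sumr -big_split; apply: ler_sum => j _ /=.
  have z0 : 0 < (f_ W eta u j 0)^-1 by rewrite invr_gt0; exact: pos_f_.
  rewrite [X in _ <= X + _]mulrA [X in _ <= _ + X]mulrA -mulrDl ler_pM2r // !mulmxBr !sub_colE -subr_ge0.
  move: (wt u j) (wt p j) (wt uhat j) => a b e.
  have -> : (1 + tau) * (b - e) ^+ 2 + (1 + tau^-1) * (a - b) ^+ 2 - (a - e) ^+ 2
    = tau^-1 * (tau * (b - e) - (a - b)) ^+ 2 by field; rewrite gt_eqF.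
  exact: mulr_ge0 (ltW i0) (sqr_ge0 _).
have Y0 : 0 <= Y.
  apply: sumr_ge0 => j _; apply: divr_ge0; [exact: sqr_ge0 | exact/ltW/pos_f_].
have hEF : E <= 2 / c * (Ff u - Ff p).
  have -> : E = 2 / c * (c / 2 * E).
    by rewrite mulrA -[2 / c]invf_div mulVf ?mul1r // gt_eqF // divr_gt0 ?c_gt0.
  by rewrite ler_pM2l ?divr_gt0 ?c_gt0 //; lra.
rewrite -2!mulrA ler_pdivlMl //.
apply: (@le_trans _ _ ((1 + tau^-1) * E)); last first.
  by rewrite -mulrA ler_pM2l // addr_gt0.
have qE : q = 1 - 2 * tau by rewrite /tau; field.
have : (1 + tau) * X <= (1 + tau) * (q * Y) by rewrite ler_pM2l // addr_gt0.
have := mulr_ge0 (mulr_ge0 (ltW tau0) (ltW tau0)) Y0.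
by rewrite qE; move: hY; move: (tau^-1) => ti; nra.
Qed.

Lemma mahalanobisE theta (x : 'cV[R]_d) : pos_orthant theta ->
  mahalanobis (invmx (prior_precision W theta)) x =
  Num.sqrt (\sum_j wt x j ^+ 2 / theta j 0).
Proof. by move=> pth; rewrite /mahalanobis invmxK prior_precisionE. Qed.

(** * Convergence of the iterates and its linear rate *)

Section Iterates.
Variable v : nat -> 'cV[R]_d.
Hypothesis v_step : forall l, stationary (f_ W eta (v l)) (v l.+1).

Lemma F_iterates_nonincreasing : nonincreasing_seq (fun l => Ff (v l)).
Proof.
apply/nonincreasing_seqP => l; apply: le_trans (F_decrease (v_step l)).
rewrite lerDl; apply: mulr_ge0; first by rewrite divr_ge0 // ltW // c_gt0.
by apply: sumr_ge0 => j _; apply: divr_ge0; [exact: sqr_ge0 | exact/ltW/pos_f_].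
Qed.

(** The values F (v l) decrease and are bounded below by F uhat, hence converge. *)
Lemma F_iterates_gap_cvg0 : Ff (v l) - Ff (v l.+1) @[l --> \oo] --> 0.
Proof.
have /cvg_ex[/= z gz] : cvgn (fun l => Ff (v l)).
  apply: nonincreasing_is_cvgn F_iterates_nonincreasing _.
  by exists (Ff uhat) => _ [l _ <-].
rewrite -[X in _ --> X](subrr z); apply: cvgB => //.
by rewrite -cvg_shiftS in gz.
Qed.

(** The iterates stay in the sublevel set of the first one, where the weights f_j are at most B. The
    unweighted squared error is then at most B C times the decrease of F, which tends to 0. *)
Lemma wt_iterates_cvg j : wt (v l) j @[l --> \oo] --> wt uhat j.
Proof.
have [C C0 hC] := dist_le_decrease; set B := 2 * sublevel_bound (Ff (v 0%N)).
have sq_le l : wt (v l - uhat) j ^+ 2 <= B * C * (Ff (v l) - Ff (v l.+1)).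
  have [_ hB] := F_sublevel j (F_iterates_nonincreasing (leq0n l)).
  have f0 := pos_f_ (v l) j.
  have hj : wt (v l - uhat) j ^+ 2 / f_ W eta (v l) j 0 <=
      C * (Ff (v l) - Ff (v l.+1)).
    apply: le_trans (hC _ _ (v_step l)); rewrite [leRHS](bigD1 j) //= lerDl.
    apply: sumr_ge0 => i _.
    by apply: divr_ge0; [exact: sqr_ge0 | exact/ltW/pos_f_].
  have D0 := le_trans (divr_ge0 (sqr_ge0 _) (ltW f0)) hj.
  rewrite ler_pdivrMr // mulrC in hj; apply: le_trans hj _.
  by rewrite -mulrA ler_wpM2r.
have dc : wt (v l - uhat) j @[l --> \oo] --> 0.
  apply/norm_cvg0P.
  have sc : wt (v l - uhat) j ^+ 2 @[l --> \oo] --> 0.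
    apply: (@squeeze_cvgr _ _ _ _ (fun=> 0) (fun l => B * C * (Ff (v l) - Ff (v l.+1)))).
    - by apply: nearW => l; rewrite sqr_ge0 sq_le.
    - exact: cvg_cst.
    - rewrite -(mulr0 (B * C)); apply: cvgM; first exact: cvg_cst.
      exact: F_iterates_gap_cvg0.
  rewrite -(sqrtr0 R) (_ : (fun l => _) = fun l => Num.sqrt (wt (v l - uhat) j ^+ 2)).
    exact: continuous_cvg (@sqrt_continuous R _) sc.
  by apply/funext => l; rewrite sqrtr_sqr.
have -> : (fun l => wt (v l) j) = fun l => wt (v l - uhat) j + wt uhat j.
  by apply/funext => l; rewrite mulmxBr sub_colE subrK.
by rewrite -[X in _ --> X]add0r; apply: cvgD => //; exact: cvg_cst.
Qed.

Lemma iterates_cvg : v l @[l --> \oo] --> uhat.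
Proof.
apply: cvg_matrix_coord => i j; rewrite (ord1 j) [uhat in X in _ --> X]synthesis.
have -> : (fun l => v l i 0) = fun l => (W *m (W^T *m v l)) i 0.
  by apply/funext => l; rewrite -synthesis.
by apply: cvg_mulmx_coord => s; exact: wt_iterates_cvg.
Qed.

(* The one-step contraction holds in the norm weighted by the current theta; as
   theta tends to thetahat, changing to the limit weights costs a factor close to 1. *)
Lemma iterates_linear : exists (rho : R) (l0 : nat), [/\ 0 < rho, rho < 1 &
  forall l, (l0 <= l)%N ->
    mahalanobis (invmx (prior_precision W thetahat)) (v l.+1 - uhat) <=
    rho * mahalanobis (invmx (prior_precision W thetahat)) (v l - uhat)].
Proof.
have q0 := contraction_rate_ge0; have q1 := contraction_rate_lt1.
set q := contraction_rate in q0 q1.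
(* The weights are changed twice, at a cost of [al] each; [al] is small enough for al^2 q <= r. The
   midpoint r of q and 1 is positive even when q = 0. The sums are squared norms, so the rate is
   sqrt r. *)
pose al := 1 + (1 - q) / 6; pose r := (1 + q) / 2.
have al1 : 1 < al by rewrite /al; lra.
have al0 : 0 < al by exact: lt_trans al1.
have alr : al * q * al <= r by rewrite /al /r; nra.
have r0 : 0 < r by rewrite /r; lra.
have tc j : f_ W eta (v l) j 0 @[l --> \oo] --> thetahat j 0.
  rewrite f_E; under eq_fun do rewrite f_E.
  exact: continuous_cvg (@theta_opt_continuous _ _ _) (wt_iterates_cvg (j := j)).
have [l0 _ hl0] : \forall l \near \oo, forall j,
    f_ W eta (v l) j 0 <= al * thetahat j 0 /\
    thetahat j 0 <= al * f_ W eta (v l) j 0.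
  apply: filter_forall => j; have t0 := pos_f_ uhat j.
  have h1 : thetahat j 0 < al * thetahat j 0 by rewrite ltr_pMl.
  have h2 : thetahat j 0 / al < thetahat j 0 by rewrite ltr_pdivrMr // ltr_pMr.
  near=> l; split; apply: ltW; first by near: l; exact: cvgr_lt h1.
  by rewrite -ltr_pdivrMl // mulrC; near: l; exact: cvgr_gt h2.
exists (Num.sqrt r), l0; split.
- by rewrite sqrtr_gt0.
- by rewrite -sqrtr1 ltr_sqrt // /r; lra.
move=> l /hl0 hl; rewrite !mahalanobisE; try exact: pos_f_.
rewrite -sqrtrM ?(ltW r0) // ler_wsqrtr //.
have ge0 a : 0 <= a ^+ 2 :> R by exact: sqr_ge0.
have hX : \sum_j wt (v l.+1 - uhat) j ^+ 2 / thetahat j 0 <=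
    al * \sum_j wt (v l.+1 - uhat) j ^+ 2 / f_ W eta (v l) j 0.
  rewrite mulr_sumr; apply: ler_sum => j _; have [hj _] := hl j.
  rewrite mulrCA ler_wpM2l // ler_pdivlMr ?(pos_f_ _ j) // mulrC.
  by rewrite ler_pdivrMr ?(pos_f_ _ j).
have hY : \sum_j wt (v l - uhat) j ^+ 2 / f_ W eta (v l) j 0 <=
    al * \sum_j wt (v l - uhat) j ^+ 2 / thetahat j 0.
  rewrite mulr_sumr; apply: ler_sum => j _; have [_ hj] := hl j.
  rewrite mulrCA ler_wpM2l // ler_pdivlMr ?(pos_f_ _ j) // mulrC.
  by rewrite ler_pdivrMr ?(pos_f_ _ j).
have Z0 : 0 <= \sum_j wt (v l - uhat) j ^+ 2 / thetahat j 0.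
  by apply: sumr_ge0 => j _; apply: divr_ge0 => //; exact/ltW/pos_f_.
apply: le_trans hX _; apply: le_trans (ler_wpM2r Z0 alr).
rewrite -!mulrA ler_pM2l //; apply: le_trans (step_contraction (v_step l)) _.
by rewrite ler_wpM2l.
Unshelve. all: by end_near.
Qed.

End Iterates.
End AtMinimizer.
End Objective.

Theorem theorem2p8 (R : realType) (n d k : nat) (A : 'M[R]_(n, d))
    (y : 'cV[R]_n) (lambda : R) (W : 'M[R]_(d, k)) (eta : R)
    (hn : (0 < n)%N) (hlambda : 0 < lambda) (hW : W *m W^T = 1%:M)
    (heta : 0 < eta) :
  strictly_convex_on J_domain (J A y lambda W eta) /\
  exists (uhat : 'cV[R]_d) (thetahat : 'cV[R]_k),
    [/\ is_unique_minimizer J_domain (J A y lambda W eta) (uhat, thetahat),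
        forall (theta0 : 'cV[R]_k) (u : nat -> 'cV[R]_d)
            (theta : nat -> 'cV[R]_k),
          pos_orthant theta0 -> oias_iterates A y lambda W eta theta0 u theta ->
          converges_at_least_linearly
            (mahalanobis (invmx (prior_precision W thetahat))) u uhat &
        is_unique_minimizer setT (F A y lambda W eta) uhat].
Proof.
split; first exact: J_strictly_convex.
have [uhat uhat_min] := F_minimizer_exists A y hlambda hW heta.
exists uhat, (f_ W eta uhat); split.
- exact: J_unique_minimizer.
- move=> theta0 u theta pth0 [th0 uS thS].
  (* The initial theta0 need not have the form f(u), so the argument runs on the shifted sequence u
     1, u 2, ..., and the threshold becomes [l0.+1]. *)
  have v_step l : stationary A y lambda W (f_ W eta (u l.+1)) (u l.+2).
    by rewrite (uS l.+1) thS; apply: ias_u_stationary => //; exact: pos_f_.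
  split.
    rewrite -cvg_shiftS.
    exact: (iterates_cvg (v := fun l => u l.+1) hlambda hW heta uhat_min v_step).
  have [rho [l0 [rho0 rho1 hl0]]] :=
    iterates_linear (v := fun l => u l.+1) hlambda hW heta uhat_min v_step.
  by exists rho, l0.+1; split=> // -[//|l] /hl0.
- exact: F_unique_minimizer.
Qed.
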